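(* Assume the standing setup with $Z=\mathbb{Z}/p$, $p$ prime. Let $G$ be a profinite group, $N$ a closed normal subgroup of $G$ contained in $\bar T(G)$, and $\pi\colon G\to G/N$ the projection. Let $\bar\pi\colon G\to G/\bar T(G)$ be the projection, let $\inf\colon H^2(G/\bar T(G))\to H^2(G/N)$ be inflation, and let $\Pi\subseteq H^2(G/\bar T(G))$ be the set of all pullbacks $\bar\rho^*(\alpha_\omega)$ with $\omega\in\Omega$ and $\bar\rho\colon G/\bar T(G)\to\bar{\mathbb{U}}_\omega$ a $\bar\pi$-liftable continuous homomorphism. The following are equivalent: (a) $\pi[T(G)]=T(G/N)$; (b) $\langle\Pi\cap\operatorname{Ker}(\inf)\rangle=\langle\Pi\rangle\cap\operatorname{Ker}(\inf)$, where $\langle\cdot\rangle$ denotes the generated subgroup.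
   Context: Standing setup: all homomorphisms of profinite groups are continuous. For profinite groups $\mathbb{U}$ and $G$, $T^{\mathbb{U}}(G)$ denotes the intersection of the kernels of all continuous homomorphisms $G\to\mathbb{U}$. Fix a finite abelian group $Z$ and a nonempty set $\Omega$ of central extensions of profinite groups $\omega\colon 0\to Z\to\mathbb{U}_\omega\xrightarrow{\lambda_\omega}\bar{\mathbb{U}}_\omega\to1$ such that for every $\omega$: (I) there are finitely many continuous homomorphisms $\gamma_1,\dots,\gamma_n\colon\bar{\mathbb{U}}_\omega\to\mathbb{U}_\omega$ with $\bigcap_i\operatorname{Ker}(\gamma_i)=\{1\}$; (II) $Z$ embeds as a closed subgroup of $\bar{\mathbb{U}}_\omega$. For a profinite group $G$ set $T(G)=\bigcap_{\omega\in\Omega}T^{\mathbb{U}_\omega}(G)$ and $\bar T(G)=\bigcap_{\omega\in\Omega}T^{\bar{\mathbb{U}}_\omega}(G)$. Here $H^i(G)=H^i(G,\mathbb{Z}/p)$ with trivial action. $\alpha_\omega\in H^2(\bar{\mathbb{U}}_\omega)$ is the class of $\omega$, and $\bar\rho^*(\alpha_\omega)$ its pullback along $\bar\rho$. A continuous $\bar\rho\colon G/\bar T(G)\to\bar{\mathbb{U}}_\omega$ is $\bar\pi$-liftable if there is a continuous $\rho\colon G\to\mathbb{U}_\omega$ with $\lambda_\omega\circ\rho=\bar\rho\circ\bar\pi$. *)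

(* Defs.v *)
From HB Require Import structures.
From mathcomp Require Import all_boot all_order all_algebra.
From mathcomp Require Import boolp classical_sets topology.
Set Implicit Arguments. Unset Strict Implicit. Unset Printing Implicit Defensive.
Import GRing.Theory.
Local Open Scope classical_set_scope.
Local Open Scope ring_scope.

Record profinGroup := ProfinGroup {
  pg_sort :> topologicalType;
  pg_mul : pg_sort -> pg_sort -> pg_sort;
  pg_one : pg_sort;
  pg_inv : pg_sort -> pg_sort;
  pg_mulA : forall x y z, pg_mul x (pg_mul y z) = pg_mul (pg_mul x y) z;
  pg_mul1g : forall x, pg_mul pg_one x = x;
  pg_mulVg : forall x, pg_mul (pg_inv x) x = pg_one;
  pg_mul_cont : continuous (fun xy : pg_sort * pg_sort => pg_mul xy.1 xy.2);
  pg_inv_cont : continuous pg_inv;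
  pg_compact : compact [set: pg_sort];
  pg_hausdorff : hausdorff_space pg_sort;
  pg_tdisc : totally_disconnected [set: pg_sort] }.

Arguments pg_mul {p}. Arguments pg_one {p}. Arguments pg_inv {p}.

Definition chom (G H : profinGroup) (f : G -> H) : Prop :=
  continuous f /\ forall x y : G, f (pg_mul x y) = pg_mul (f x) (f y).

Definition hkernel (G H : profinGroup) (f : G -> H) : set G :=
  [set x | f x = pg_one].

Definition closed_normal_subgroup (G : profinGroup) (N : set G) : Prop :=
  [/\ closed N, N pg_one,
      (forall x y, N x -> N y -> N (pg_mul x (pg_inv y)))
    & (forall x y, N x -> N (pg_mul (pg_inv y) (pg_mul x y)))].

Definition T_U (U G : profinGroup) : set G :=
  [set g | forall f : G -> U, chom f -> f g = pg_one].

(* Central extensions 0 -> Z/p -> U -> Ubar -> 1 of profinite groups.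
   (Continuity of iota and the fact that iota is a closed embedding are
   automatic since Z/p is finite discrete and U is Hausdorff.) *)
Record cext (p : nat) := CExt {
  ce_U : profinGroup;
  ce_Ub : profinGroup;
  ce_iota : 'Z_p -> ce_U;
  ce_lam : ce_U -> ce_Ub;
  ce_iota_hom : forall a b, ce_iota (a + b) = pg_mul (ce_iota a) (ce_iota b);
  ce_iota_inj : injective ce_iota;
  ce_lam_hom : chom ce_lam;
  ce_lam_surj : forall y, exists x, ce_lam x = y;
  ce_exact : forall u, ce_lam u = pg_one <-> exists a, ce_iota a = u;
  ce_central : forall a u, pg_mul (ce_iota a) u = pg_mul u (ce_iota a) }.

Arguments ce_U {p} c. Arguments ce_Ub {p} c.
Arguments ce_iota {p} c _. Arguments ce_lam {p} c _.

Definition condI p (w : cext p) : Prop :=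
  exists n (gam : 'I_n -> ce_Ub w -> ce_U w),
    (forall i, chom (gam i)) /\
    forall x, (forall i, gam i x = pg_one) -> x = pg_one.

(* condition (II): Z/p embeds as a (necessarily closed, being finite)
   subgroup of Ubar *)
Definition condII p (w : cext p) : Prop :=
  exists e : 'Z_p -> ce_Ub w, injective e /\
    forall a b, e (a + b) = pg_mul (e a) (e b).

Arguments T_U : clear implicits.
Definition Tset p I (Om : I -> cext p) (G : profinGroup) : set G :=
  [set g | forall i, T_U (ce_U (Om i)) G g].
Definition Tbar p I (Om : I -> cext p) (G : profinGroup) : set G :=
  [set g | forall i, T_U (ce_Ub (Om i)) G g].

Definition locconst (T : topologicalType) (R : Type) (f : T -> R) : Prop :=
  forall x, exists U : set T, [/\ open U, U x & forall y, U y -> f y = f x].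

Definition cocycle2 p (G : profinGroup) (f : G * G -> 'Z_p) : Prop :=
  locconst f /\ forall g h k : G,
    f (h, k) - f (pg_mul g h, k) + f (g, pg_mul h k) - f (g, h) = 0.

Definition coboundary2 p (G : profinGroup) (f : G * G -> 'Z_p) : Prop :=
  exists c : G -> 'Z_p, locconst c /\
    forall g h : G, f (g, h) = c h - c (pg_mul g h) + c g.

(* cohomology classes are represented as cosets z + B^2(G) *)
Definition h2class p (G : profinGroup) (z : G * G -> 'Z_p) : set (G * G -> 'Z_p) :=
  [set w | coboundary2 (fun x => w x - z x)].

Definition isH2 p (G : profinGroup) (A : set (G * G -> 'Z_p)) : Prop :=
  exists z, cocycle2 z /\ A = h2class z.

Definition h2zero p (G : profinGroup) : set (G * G -> 'Z_p) :=
  h2class (fun _ => 0).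
Definition h2add p (G : profinGroup) (A B : set (G * G -> 'Z_p)) :=
  [set w | exists a b, [/\ A a, B b & w = (fun x => a x + b x)]].
Definition h2opp p (G : profinGroup) (A : set (G * G -> 'Z_p)) :=
  [set w | A (fun x => - w x)].

Definition h2gen p (G : profinGroup) (X : set (set (G * G -> 'Z_p))) :
    set (set (G * G -> 'Z_p)) :=
  [set A | isH2 A /\
     forall S : set (set (G * G -> 'Z_p)),
       S (@h2zero p G) ->
       (forall B C, S B -> S C -> S (h2add B C)) ->
       (forall B, S B -> S (h2opp B)) ->
       X `<=` S -> S A].

Definition h2pull p (G H : profinGroup) (f : G -> H) (A : set (H * H -> 'Z_p)) :
    set (G * G -> 'Z_p) :=
  [set w | exists z, A z /\ coboundary2 (fun x => w x - z (f x.1, f x.2))].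

Definition ext_class p (w : cext p) : set (ce_Ub w * ce_Ub w -> 'Z_p) :=
  [set c | exists (s : ce_Ub w -> ce_U w) (f : ce_Ub w * ce_Ub w -> 'Z_p),
     [/\ continuous s, (forall x, ce_lam w (s x) = x),
         (forall x y, ce_iota w (f (x, y)) =
            pg_mul (pg_mul (s x) (s y)) (pg_inv (s (pg_mul x y))))
       & coboundary2 (fun x => c x - f x)]].

Arguments ext_class {p} w.

Definition liftable p (w : cext p) (G Gb : profinGroup) (pib : G -> Gb)
    (rb : Gb -> ce_Ub w) : Prop :=
  exists rho : G -> ce_U w, chom rho /\ forall g, ce_lam w (rho g) = rb (pib g).

Definition PiSet p I (Om : I -> cext p) (G Gb : profinGroup) (pib : G -> Gb) :
    set (set (Gb * Gb -> 'Z_p)) :=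
  [set A | exists i (rb : Gb -> ce_Ub (Om i)),
     [/\ chom rb, liftable pib rb & A = h2pull rb (ext_class (Om i))]].

Definition Kerinf p (Q Gb : profinGroup) (q : Q -> Gb) : set (set (Gb * Gb -> 'Z_p)) :=
  [set A | isH2 A /\ h2pull q A = @h2zero p Q].

Arguments Tset {p I} Om G _.
Arguments Tbar {p I} Om G _.
Arguments PiSet {p I} Om {G Gb} pib _.
Arguments Kerinf p {Q Gb} q _.

(* Main.v *)
Require Import Defs.
From HB Require Import structures.
From mathcomp Require Import all_boot all_order all_algebra.
From mathcomp Require Import boolp classical_sets topology.
From mathcomp Require Import ring.

(* Let [V] be the intersection of the kernels of all [G -> Ubar_w]; it contains
   [N]. Compactness yields a locally constant [c_w : U_w -> Z/p] with
   [c_w (z u) = z + c_w u] for [z] in [Z/p], and every [rho : G -> U_w] gives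
   [c = c_w o rho] with [c (v g) = c (g v) = c v + c g] for [v] in [V]. The
   coboundary of such a [c] descends to a 2-cocycle on [G/V], whose class is, up
   to sign, the transgression of the invariant character [c|V]; for [c_w o rho]
   it is the pullback of the class of the extension. By (II) every character of
   [G] kills [V], so the class determines [c|V], and it dies in [H^2(G/N)] iff
   [c|N = 0].
   With [P] the set of all [c_w o rho] and [P0] the subset of those vanishing on
   [N], T(G) is the common kernel of [P] in [V] (by (I)) and the preimage of
   T(G/N) is the common kernel of [P0] in [V]. By Pontryagin duality for
   [V / T(G)], an elementary abelian group, (a) and (b) both say that every
   element of the span of [P] vanishing on [N] agrees on [V] with an element of
   the span of [P0]. *)

Set Implicit Arguments. Unset Strict Implicit. Unset Printing Implicit Defensive.
Import GRing.Theory.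
Local Open Scope ring_scope.
Local Open Scope classical_set_scope.

(** * Compactness and locally constant functions *)

(** The finite intersections of members of [D], traced on [A], generate a proper filter; a cluster
    point of it in [A] lies in every closed member. Finite subfamilies are sequences so that later
    arguments can induct on them. *)
Lemma compact_seq_fip (T : topologicalType) (A : set T) (D : set (set T)) :
  compact A -> (forall B, D B -> closed B) ->
  (forall s : seq (set T), (forall B, B \in s -> D B) ->
     exists2 x, A x & forall B, B \in s -> B x) ->
  exists2 x, A x & forall B, D B -> B x.
Proof.
move=> cA clD fip.
pose F : set_system T := [set E | exists2 s : seq (set T),
  (forall B, B \in s -> D B) &
  forall x, A x -> (forall B, B \in s -> B x) -> E x].
have FF : ProperFilter F.
  apply: Build_ProperFilter_ex => [E [s sD sE]|].
    by have [x Ax xs] := fip s sD; exists x; apply: sE.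
  split=> [|E1 E2 [s1 D1 E1s] [s2 D2 E2s]|E1 E2 E12 [s sD sE]].
  - by exists [::].
  - exists (s1 ++ s2) => [B|x Ax xs].
      by rewrite mem_cat => /orP[/D1|/D2].
    by split; [apply: E1s|apply: E2s] => // B Bs; apply: xs;
      rewrite mem_cat Bs ?orbT.
  - by exists s => // x Ax xs; apply/E12/sE.
have FA : F A by exists [::].
have [x [Ax clx]] := cA F FF FA.
exists x => // B DB; apply: (clD _ DB) => W; apply: clx.
by exists [:: B] => [C|y _]; [rewrite inE => /eqP->|apply; rewrite inE].
Qed.

Lemma seq_clopen_capI (T : topologicalType) (s : seq (set T)) :
  (forall B, B \in s -> clopen B) ->
  clopen [set x | forall B, B \in s -> B x].
Proof.
elim: s => [|B s IHs] sD.
  by rewrite (_ : [set x | _] = setT) //; [split; [apply: openT|apply: closedT]|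
    apply/seteqP; split].
have -> : [set x | forall C, C \in B :: s -> C x] =
    B `&` [set x | forall C, C \in s -> C x].
  apply/seteqP; split=> x /=.
    by move=> h; split=> [|C Cs]; apply: h; rewrite inE ?eqxx ?Cs ?orbT.
  by move=> [Bx h] C; rewrite inE => /orP[/eqP->//|/h].
have [oB cB] := sD B (mem_head _ _).
have [os cs] := IHs (fun C Cs => sD C (mem_behead (s := B :: s) Cs)).
by split; [apply: openI|apply: closedI].
Qed.

(* In a compact Hausdorff space the intersection of the clopen neighbourhoods
   of a point is connected, hence contained in its connected component. *)
Lemma compact_totally_disconnected_zero_dimensional (T : topologicalType) :
  hausdorff_space T -> compact [set: T] -> totally_disconnected [set: T] ->
  zero_dimensional T.
Proof.
move=> hT cT tdT x y /eqP xy; apply: contrapT => nsep.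
pose D : set (set T) := [set C | clopen C /\ C x].
pose K : set T := [set z | forall C, D C -> C z].
have Ky : K y.
  by move=> C [cC Cx]; apply: contrapT => nCy; apply: nsep; exists C.
have Kx : K x by move=> C [].
have clK : closed K.
  have -> : K = \bigcap_(C in D) C by apply/seteqP; split.
  by apply: closed_bigI => C [[_]].
suff cK : connected K.
  apply: xy; have : connected_component setT x y by exists K.
  by rewrite tdT.
(* [B] is a nonempty relatively clopen part of [K] and [B'] is the rest of [K]. Normality puts them
   into disjoint open sets [U] and [V]; the aim is to cut these down to clopen sets. *)
move=> B B0 [C1 oC1 BC1] [C2 cC2 BC2].
have clB : closed B by rewrite BC2; apply: closedI.
pose B' := K `\` B.
have clB' : closed B'.
  rewrite /B' BC1 (_ : _ `\` _ = K `&` ~` C1).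
    by apply: closedI => //; rewrite closedC.
  apply/seteqP; split=> z /= [Kz h]; split=> //.
    by move=> C1z; apply: h.
  by move=> [_ /h].
have BK : B `<=` K by rewrite BC1 => z [].
have : set_nbhs B (~` B').
  by move=> z Bz; apply: open_nbhs_nbhs; split; [rewrite openC|case].
move=> /(compact_normal hT cT clB)[i iB iB'].
pose U := i°.
have oU : open U by exact: open_interior.
have BU : B `<=` U by move=> z /iB.
have clUB' : closure U `<=` ~` B'.
  exact: subset_trans (closure_subset (@interior_subset _ i)) iB'.
pose V := ~` closure U.
have oV : open V by rewrite openC; apply: closed_closure.
have B'V : B' `<=` V.
  by move=> z B'z Uz; apply: (clUB' z).
have UV z : U z -> ~ V z by move=> Uz; apply; apply: subset_closure.
(* The complement of [U] and [V] is compact and misses [K], so finitely many clopen neighbourhoods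
   of [x] already have their intersection [C] inside the union of [U] and [V]. Then [U] and [V] both
   meet [C] in clopen sets, and the one containing [x] contains all of [K]. *)
have [s sD sUV] : exists2 s : seq (set T), (forall C, C \in s -> D C) &
    forall z, (forall C, C \in s -> C z) -> U z \/ V z.
  apply: contrapT => nos.
  have cW : compact (~` (U `|` V)).
    by apply: subclosed_compact cT _ => //; rewrite closedC; apply: openU.
  have [|s sD|z nUV Kz] := compact_seq_fip (D := D) cW.
  - by move=> C [[]].
  - apply: contrapT => noz; apply: nos; exists s => // z zs.
    apply: contrapT => nUV; apply: noz; exists z => //.
  - apply: nUV; have [Bz|nBz] := EM (B z); first by left; apply: BU.
    by right; apply: B'V.
pose C := [set z | forall E, E \in s -> E z].
have [oC cC] : clopen C by apply: seq_clopen_capI => E /sD[].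
have Cx : C x by move=> E /sD[].
have CU : clopen (C `&` U).
  split; first exact: openI.
  rewrite (_ : C `&` U = C `&` ~` V); first by apply: closedI; rewrite ?closedC.
  apply/seteqP; split=> z [Cz h]; split => //; first exact: UV.
  by have [] := sUV z Cz.
have CV : clopen (C `&` V).
  split; first exact: openI.
  rewrite (_ : C `&` V = C `&` ~` U); first by apply: closedI; rewrite ?closedC.
  apply/seteqP; split=> z [Cz h]; split => //; first by move=> /UV.
  by have [] := sUV z Cz.
have [Bx|nBx] := EM (B x).
  apply/seteqP; split=> // z Kz; apply: contrapT => nBz.
  have [_ Uz] : (C `&` U) z by apply: Kz; split=> //; split=> //; apply: BU.
  by apply: UV Uz _; apply: B'V.
have [z Bz] := B0.
have [_ Vz] : (C `&` V) z.
  by apply: (BK _ Bz); split=> //; split=> //; apply: B'V.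
by case: (UV z) => //; apply: BU.
Qed.

(** A continuous map from a compact space to a Hausdorff space is closed, so a surjective one is a
    quotient map. Local constancy and continuity therefore descend along it. *)
Lemma compact_surj_closed_preimage (S T : topologicalType) (f : S -> T) (B : set T) :
  compact [set: S] -> hausdorff_space T -> continuous f ->
  (forall y, exists x, f x = y) -> closed (f @^-1` B) -> closed B.
Proof.
move=> cS hT cf sf clB.
have -> : B = f @` (f @^-1` B).
  apply/seteqP; split=> [y By|y [x Bx <-]//].
  by have [x xy] := sf y; exists x; rewrite //= xy.
apply: compact_closed => //; apply: continuous_compact.
  exact: continuous_subspaceT.
exact: subclosed_compact clB cS _.
Qed.

Lemma locconstP (T : topologicalType) (R : Type) (f : T -> R) :
  locconst f <-> forall A : set R, open (f @^-1` A).
Proof.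
split=> [lf A|of_ x]; last first.
  by exists (f @^-1` [set f x]); split => //.
rewrite openE => x /= Afx; have [U [oU Ux Uf]] := lf x.
rewrite /interior nbhsE; exists U; first by split.
by move=> y /Uf /= ->.
Qed.

Lemma locconst_closed (T : topologicalType) (R : Type) (f : T -> R) (A : set R) :
  locconst f -> closed (f @^-1` A).
Proof.
by move=> /locconstP lf; rewrite -openC preimage_setC; apply: lf.
Qed.

Lemma locconst_continuous (S T : topologicalType) (f : S -> T) :
  locconst f -> continuous f.
Proof. by move=> /locconstP lf; apply/continuousP => A _; apply: lf. Qed.

Lemma locconst_comp (S T : topologicalType) (R : Type) (g : S -> T) (f : T -> R) :
  continuous g -> locconst f -> locconst (fun x => f (g x)).
Proof.
move=> /continuousP cg /locconstP lf; apply/locconstP => A.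
exact: cg (lf A).
Qed.

Lemma locconst_map (T : topologicalType) (R R' : Type) (h : R -> R') (f : T -> R) :
  locconst f -> locconst (fun x => h (f x)).
Proof.
move=> lf x; have [U [oU Ux Uf]] := lf x.
by exists U; split=> // y /Uf ->.
Qed.

Lemma locconst_map2 (T : topologicalType) (R1 R2 R : Type) (h : R1 -> R2 -> R)
  (f : T -> R1) (g : T -> R2) :
  locconst f -> locconst g -> locconst (fun x => h (f x) (g x)).
Proof.
move=> lf lg x; have [U [oU Ux Uf]] := lf x; have [V [oV Vx Vg]] := lg x.
exists (U `&` V); split=> //; first exact: openI.
by move=> y [/Uf -> /Vg ->].
Qed.

Lemma locconst_cst (T : topologicalType) (R : Type) (a : R) :
  locconst (fun _ : T => a).
Proof. by move=> x; exists setT; split=> //; apply: openT. Qed.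

Lemma locconst_descends (S T : topologicalType) (R : Type) (f : S -> T) (h : T -> R) :
  compact [set: S] -> hausdorff_space T -> continuous f ->
  (forall y, exists x, f x = y) -> locconst (fun x => h (f x)) -> locconst h.
Proof.
move=> cS hT cf sf lh; apply/locconstP => A.
rewrite -closedC preimage_setC.
by apply: (compact_surj_closed_preimage cS hT cf sf); apply: locconst_closed lh.
Qed.

Lemma continuous_descends (S T T' : topologicalType) (f : S -> T) (h : T -> T') :
  compact [set: S] -> hausdorff_space T -> continuous f ->
  (forall y, exists x, f x = y) -> continuous (h \o f) -> continuous h.
Proof.
move=> cS hT cf sf ch; apply/continuous_closedP => A clA.
apply: (compact_surj_closed_preimage cS hT cf sf).
by move/continuous_closedP: ch; apply.
Qed.

Lemma hausdorff_prod (S T : topologicalType) :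
  hausdorff_space S -> hausdorff_space T -> hausdorff_space (S * T)%type.
Proof.
move=> hS hT [x1 x2] [y1 y2] clxy; congr (_, _).
  apply: hS => A B Ax By; have [||[z1 z2] [/= Az Bz]] :=
    clxy (A `*` setT) (B `*` setT).
  - by exists (A, setT) => //=; split=> //; apply: filterT.
  - by exists (B, setT) => //=; split=> //; apply: filterT.
  - by exists z1; split; [case: Az|case: Bz].
apply: hT => A B Ax By; have [||[z1 z2] [/= Az Bz]] :=
  clxy (setT `*` A) (setT `*` B).
- by exists (setT, A) => //=; split=> //; apply: filterT.
- by exists (setT, B) => //=; split=> //; apply: filterT.
- by exists z2; split; [case: Az|case: Bz].
Qed.

Lemma locconst_big (T : topologicalType) (R I : Type) (op : R -> R -> R) (idx : R)
  (r : seq I) (Q : pred I) (f : I -> T -> R) :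
  (forall i, locconst (f i)) ->
  locconst (fun x => \big[op/idx]_(i <- r | Q i) f i x).
Proof.
move=> lf; elim: r => [|i r IHr].
  by under eq_fun do rewrite big_nil; apply: locconst_cst.
under eq_fun do rewrite big_cons.
by case: (Q i) => //; apply: locconst_map2.
Qed.

Lemma clopen_locconst (T : topologicalType) (D : set T) :
  clopen D -> locconst (fun x => `[< D x >]).
Proof.
move=> [oD cD] x; have [Dx|nDx] := EM (D x).
  by exists D; split=> // y Dy; rewrite !asboolT.
exists (~` D); split=> //; first by rewrite openC.
by move=> y nDy; rewrite !asboolF.
Qed.

(** The sets where [c] takes the value [t c] are closed, so compactness applies. The target is a
    function [t] of [c] to cover both [t = 0] and evaluation at a point. *)
Lemma compact_seq_agree (T : topologicalType) (p : nat) (A : set T)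
  (X : set (T -> 'Z_p)) (t : (T -> 'Z_p) -> 'Z_p) :
  compact A -> (forall c, X c -> locconst c) ->
  (forall s : seq (T -> 'Z_p), (forall c, c \in s -> X c) ->
     exists2 x, A x & forall c, c \in s -> c x = t c) ->
  exists2 x, A x & forall c, X c -> c x = t c.
Proof.
move=> cA lX fip.
pose D : set (set T) := [set B | exists2 c, X c & B = c @^-1` [set t c]].
have [|s sD|x Ax xD] := compact_seq_fip (D := D) cA.
- by move=> B [c Xc ->]; apply: locconst_closed; apply: lX.
- have [s' s'X s's] : exists2 s' : seq (T -> 'Z_p), (forall c, c \in s' -> X c) &
      forall x, (forall c, c \in s' -> c x = t c) -> forall B, B \in s -> B x.
    elim: s sD => [|B s IHs] sD; first by exists [::].
    have [c Xc Bc] := sD B (mem_head _ _).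
    have [s' s'X s's] := IHs (fun C Cs => sD C (mem_behead (s := B :: s) Cs)).
    exists (c :: s') => [d|x h C]; rewrite inE => /orP[/eqP->//|].
    + exact: s'X.
    + by rewrite Bc; apply: h; rewrite mem_head.
    + by apply: s's => d ds'; apply: h; rewrite inE ds' orbT.
  by have [x Ax xs'] := fip s' s'X; exists x => //; apply: s's.
- by exists x => // c Xc; apply: (xD (c @^-1` [set t c])); exists c.
Qed.

(** * Profinite groups *)

Local Infix "**" := pg_mul (at level 40, left associativity).

Section ProfiniteGroup.
Variable G : profinGroup.
Implicit Types x y : G.

Lemma pg_mulKg x y : pg_inv x ** (x ** y) = y.
Proof. by rewrite pg_mulA pg_mulVg pg_mul1g. Qed.

Lemma pg_mulgI x y z : x ** y = x ** z -> y = z.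
Proof. by move=> xyz; rewrite -(pg_mulKg x y) xyz pg_mulKg. Qed.

Lemma pg_mulg1 x : x ** pg_one = x.
Proof. by apply: (@pg_mulgI (pg_inv x)); rewrite pg_mulKg pg_mulVg. Qed.

Lemma pg_mulgV x : x ** pg_inv x = pg_one.
Proof. by apply: (@pg_mulgI (pg_inv x)); rewrite pg_mulKg pg_mulg1. Qed.

Lemma pg_mulVKg x y : x ** (pg_inv x ** y) = y.
Proof. by rewrite pg_mulA pg_mulgV pg_mul1g. Qed.

Lemma pg_invgK x : pg_inv (pg_inv x) = x.
Proof. by apply: (@pg_mulgI (pg_inv x)); rewrite pg_mulgV pg_mulVg. Qed.

Lemma pg_mulgK x y : x ** y ** pg_inv y = x.
Proof. by rewrite -pg_mulA pg_mulgV pg_mulg1. Qed.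

Lemma pg_idem1 x : x ** x = x -> x = pg_one.
Proof. by move=> xx; apply: (@pg_mulgI x); rewrite xx pg_mulg1. Qed.

End ProfiniteGroup.

Section ContinuousHomomorphisms.
Variables (G H K : profinGroup).
Implicit Types (f : G -> H).

Lemma chom1 f : chom f -> f pg_one = pg_one.
Proof. by move=> [_ fM]; apply: pg_idem1; rewrite -fM pg_mul1g. Qed.

Lemma chomV f x : chom f -> f (pg_inv x) = pg_inv (f x).
Proof.
move=> fh; apply: (@pg_mulgI _ (f x)); case: (fh) => _ fM.
by rewrite -fM !pg_mulgV chom1.
Qed.

Lemma chom_comp f (g : H -> K) : chom f -> chom g -> chom (g \o f).
Proof.
move=> [cf fM] [cg gM]; split=> [x|x y /=]; last by rewrite fM gM.
exact: continuous_comp (cf x) (cg (f x)).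
Qed.

Lemma chom_eq_ker f g h : chom f -> f g = f h ->
  exists2 k, f k = pg_one & g = h ** k.
Proof.
move=> fh fgh; exists (pg_inv h ** g); last by rewrite pg_mulVKg.
by case: (fh) => _ fM; rewrite fM chomV // fgh pg_mulVg.
Qed.

(** The section [s] is a mere choice without continuity; [h \o s] is continuous because [f] is a
    quotient map. *)
Lemma chom_descends f (h : G -> K) : chom f -> (forall y, exists x, f x = y) ->
  chom h -> (forall x, f x = pg_one -> h x = pg_one) ->
  exists2 h' : H -> K, chom h' & forall x, h' (f x) = h x.
Proof.
move=> fh sf hh kerf; have [s sP] := choice sf.
have h's x : h (s (f x)) = h x.
  have [k /kerf hk ->] := chom_eq_ker fh (sP (f x)).
  by case: (hh) => _ ->; rewrite hk pg_mulg1.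
exists (h \o s) => [|x]; last exact: h's.
split=> [|x y /=].
  apply: (continuous_descends (f := f)) => //.
  - exact: pg_compact.
  - exact: pg_hausdorff.
  - by case: fh.
  - rewrite (_ : (h \o s) \o f = h); first by case: hh.
    by apply/funext.
case: (hh) => _ <-; rewrite -[RHS]h's; case: (fh) => _ ->.
by rewrite !sP.
Qed.

End ContinuousHomomorphisms.

(** * Duality for [Z/p]-valued functions *)

Section FiniteDuality.
Variables (p : nat) (p_prime : prime p).

(** The closure operations mirror those of [h2gen]; scalar multiples follow since every element of
    ['Z_p] is a multiple of 1. *)
Inductive zspan (T : Type) (X : set (T -> 'Z_p)) : (T -> 'Z_p) -> Prop :=
| zspan_gen c : X c -> zspan X c
| zspan0 : zspan X (fun _ => 0)
| zspanD c c' : zspan X c -> zspan X c' -> zspan X (fun x => c x + c' x)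
| zspanN c : zspan X c -> zspan X (fun x => - c x).

Lemma zspanS (T : Type) (X Y : set (T -> 'Z_p)) : X `<=` Y -> zspan X `<=` zspan Y.
Proof.
move=> XY c; elim=> [d /XY|||].
- exact: zspan_gen.
- exact: zspan0.
- by move=> *; apply: zspanD.
- by move=> *; apply: zspanN.
Qed.

Lemma zspan_scale (T : Type) (X : set (T -> 'Z_p)) a c :
  zspan X c -> zspan X (fun x => a * c x).
Proof.
move=> Xc; rewrite -[a]natr_Zp; elim: (nat_of_ord a) => [|n IHn].
  by rewrite (_ : (fun x => _) = fun _ => 0); [apply: zspan0|apply/funext => x; ring].
rewrite (_ : (fun x => _) = fun x => n%:R * c x + c x); first exact: zspanD.
by apply/funext => x; ring.
Qed.

Lemma zspan_eq_at (T : Type) (X : set (T -> 'Z_p)) c x y :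
  zspan X c -> (forall d, X d -> d x = d y) -> c x = c y.
Proof.
move=> Xc xy; elim: Xc => [d /xy//|//|d d' _ <- _ <-//|d _ <-//].
Qed.

Section AdditiveFunctions.
Variable G : profinGroup.
Implicit Types (V W : set G) (c : G -> 'Z_p).

Definition submonoid W :=
  W pg_one /\ forall x y, W x -> W y -> W (x ** y).

Definition additive_on W c :=
  forall x y, W x -> W y -> c (x ** y) = c x + c y.

Lemma zspan_additive_on W (X : set (G -> 'Z_p)) c :
  (forall d, X d -> additive_on W d) -> zspan X c -> additive_on W c.
Proof.
move=> Xadd; elim=> [d /Xadd//||d d' _ IH _ IH'|d _ IH] x y Wx Wy.
- by rewrite addr0.
- by rewrite IH ?IH' //; ring.
- by rewrite IH //; ring.
Qed.

Lemma additive_on1 W c : submonoid W -> additive_on W c -> c pg_one = 0.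
Proof.
move=> [W1 _] cW; apply: (addrI (c pg_one)).
by rewrite -cW // pg_mul1g addr0.
Qed.

Definition pg_pow (x : G) n := iter n (pg_mul x) pg_one.

Lemma submonoid_pow W x n : submonoid W -> W x -> W (pg_pow x n).
Proof. by move=> [W1 WM] Wx; elim: n => //= n; apply: WM. Qed.

Lemma additive_on_pow W c x n : submonoid W -> additive_on W c -> W x ->
  c (pg_pow x n) = n%:R * c x.
Proof.
move=> sW cW Wx; elim: n => [|n IHn].
  by rewrite mul0r; apply: additive_on1 sW cW.
by rewrite /= cW // ?IHn; [ring|apply: submonoid_pow].
Qed.

Lemma Zp_unit (a : 'Z_p) : a != 0 -> a \is a GRing.unit.
Proof.
move=> a0; rewrite -[a]natr_Zp unitZpE ?prime_gt1 // prime_coprime //.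
rewrite gtnNdvd ?lt0n //; apply: leq_trans (ltn_ord a) _.
by rewrite Zp_cast // prime_gt1.
Qed.

(** Induction on [s], passing to the kernel [W'] of [d] in [W]. If [d] is nonzero at some [v], every
    element of [W] can be moved into [W'] by a power of [v], which leaves only the coefficient of
    [d] to be found. *)
Lemma zspan_of_common_kernel W (s : seq (G -> 'Z_p)) c : submonoid W ->
  (forall d, d \in s -> additive_on W d) -> additive_on W c ->
  (forall x, W x -> (forall d, d \in s -> d x = 0) -> c x = 0) ->
  exists2 c', zspan [set` s] c' & forall x, W x -> c x = c' x.
Proof.
elim: s W => [|d s IHs] W sW sadd cadd cker.
  by exists (fun _ => 0) => [|x Wx]; [apply: zspan0|apply: cker].
have dadd : additive_on W d by apply: sadd; rewrite mem_head.
have sadd' e : e \in s -> additive_on W e.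
  by move=> es; apply: sadd; rewrite inE es orbT.
have ss : [set` s] `<=` [set` d :: s] by move=> e /= es; rewrite inE es orbT.
pose W' := [set x | W x /\ d x = 0].
have sW' : submonoid W'.
  case: (sW) => W1 WM; split=> [|x y [Wx dx] [Wy dy]].
    by split=> //; apply: additive_on1 sW dadd.
  by split; [apply: WM|rewrite dadd // dx dy addr0].
have [|||c' sc' cc'] := IHs W' sW'.
- by move=> e /sadd' eadd x y [Wx _] [Wy _]; apply: eadd.
- by move=> x y [Wx _] [Wy _]; apply: cadd.
- move=> x [Wx dx] xs; apply: cker => // e.
  by rewrite inE => /orP[/eqP->|/xs].
have [d0|/existsNP[v /not_implyP[Wv /eqP dv]]] := EM (forall x, W x -> d x = 0).
  exists c' => [|x Wx]; first exact: zspanS ss _ sc'.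
  by apply: cc'; split=> //; apply: d0.
have udv := Zp_unit dv.
have c'add : additive_on W c' by apply: zspan_additive_on sc'.
(* This is the coefficient for which [c] and [c' + a * d] agree at [v]. *)
pose a := (c v - c' v) / d v.
exists (fun x => c' x + a * d x) => [|x Wx].
  apply: zspanD; first exact: zspanS ss _ sc'.
  by apply/zspan_scale/zspan_gen; rewrite /= mem_head.
(* The exponent is chosen so that [d] vanishes at [x ** pg_pow v n]. *)
pose n := nat_of_ord (- (d x / d v)).
have Wvn : W (pg_pow v n) by apply: submonoid_pow.
have /cc' : W' (x ** pg_pow v n).
  split; first by case: sW => _; apply.
  rewrite dadd // (additive_on_pow _ sW dadd Wv) natr_Zp mulNr divrK //.
  by rewrite subrr.
rewrite cadd // c'add // (additive_on_pow _ sW cadd Wv).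
rewrite (additive_on_pow _ sW c'add Wv) natr_Zp => /eqP.
rewrite -subr_eq0 => /eqP h; apply/eqP; rewrite -subr_eq0; apply/eqP.
by rewrite -[RHS]h /a; ring.
Qed.

(* A subgroup of [(Z/p)^k] contains every vector killed by all the linear forms
   that vanish on it. *)
Lemma simultaneous_solution W N (s : seq (G -> 'Z_p)) x :
  submonoid W -> submonoid N -> N `<=` W -> W x ->
  (forall d, d \in s -> additive_on W d) ->
  (forall c, zspan [set` s] c -> (forall n, N n -> c n = 0) -> c x = 0) ->
  exists2 n, N n & forall d, d \in s -> d n = d x.
Proof.
move=> sW sN NW Wx; elim: s => [|d s IHs] sadd sx.
  by exists pg_one => //; case: sN.
have dadd : additive_on W d by apply: sadd; rewrite mem_head.
have sadd' e : e \in s -> additive_on W e.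
  by move=> es; apply: sadd; rewrite inE es orbT.
have ss : [set` s] `<=` [set` d :: s] by move=> e /= es; rewrite inE es orbT.
have addN e : additive_on W e -> additive_on N e.
  by move=> eadd y z /NW Wy /NW Wz; apply: eadd.
have [n Nn ns] := IHs sadd' (fun c sc => sx c (zspanS ss sc)).
(* If [d] vanishes on the part of [N] killed by [s], then on [N] it is a combination [c] of [s]; as
   [d - c] vanishes on [N], it vanishes at [x], so [n] already works. Otherwise some [m] in that
   part has [d m] nonzero, and a power of [m] corrects [d n] without changing the values of [s]. *)
have [dker|] := EM (forall m, N m -> (forall e, e \in s -> e m = 0) -> d m = 0).
  have [|||c sc dc] := zspan_of_common_kernel (s := s) (c := d) sN.
  - by move=> e /sadd'/addN.
  - exact: addN.
  - exact: dker.
  exists n => // e; rewrite inE => /orP[/eqP->|/ns//].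
  rewrite dc // (zspan_eq_at (x := n) (y := x) sc) //.
  apply/esym/eqP; rewrite -subr_eq0; apply/eqP.
  apply: (sx (fun x => d x - c x)) => [|m Nm]; last by rewrite dc // subrr.
  by apply: zspanD; [apply: zspan_gen; rewrite /= mem_head|apply/zspanN/(zspanS ss)].
move=> /existsNP[m /not_implyP[Nm /not_implyP[ms /eqP dm]]].
have Wm := NW _ Nm; have Wn := NW _ Nn.
pose k := nat_of_ord ((d x - d n) / d m).
have Nmk : N (pg_pow m k) by apply: submonoid_pow.
exists (n ** pg_pow m k); first by case: sN => _; apply.
move=> e; rewrite inE => /orP[/eqP->|es].
  rewrite dadd ?(additive_on_pow _ sW dadd Wm) ?natr_Zp //; last exact: NW.
  by rewrite divrK ?Zp_unit //; ring.
have eadd := sadd' e es.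
rewrite eadd ?(additive_on_pow _ sW eadd Wm) //; last exact: NW.
by rewrite ms // mulr0 addr0 ns.
Qed.

(** The part of [V] where [c] is nonzero is compact and contains no common zero of [X], so it
    contains no common zero of some finite part of [X]. *)
Lemma closed_span_of_common_kernel V (X : set (G -> 'Z_p)) c :
  submonoid V -> closed V -> locconst c -> additive_on V c ->
  (forall d, X d -> locconst d) -> (forall d, X d -> additive_on V d) ->
  (forall x, V x -> (forall d, X d -> d x = 0) -> c x = 0) ->
  exists2 c', zspan X c' & forall x, V x -> c x = c' x.
Proof.
move=> sV clV lc cadd lX Xadd Xker.
have [s sX sker] : exists2 s : seq (G -> 'Z_p), (forall d, d \in s -> X d) &
    forall x, V x -> (forall d, d \in s -> d x = 0) -> c x = 0.
  apply: contrapT => nos.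
  have cA : compact (V `&` c @^-1` [set~ 0]).
    apply: subclosed_compact (@pg_compact G) _ => //.
    by apply: closedI => //; apply: locconst_closed.
  have [s sX|x [Vx cx] Xx] := compact_seq_agree (t := fun _ => 0) cA lX.
    apply: contrapT => nox; apply: nos; exists s => // x Vx xs.
    by apply: contrapT => cx; apply: nox; exists x.
  by apply: cx; apply: Xker.
have [|c' sc' cc'] := zspan_of_common_kernel sV _ cadd sker.
  by move=> d /sX/Xadd.
by exists c' => //; apply: zspanS sc' => d /sX.
Qed.

(** Compactness of [N] reduces the claim to finite parts of [X]. *)
Lemma closed_simultaneous_solution V N (X : set (G -> 'Z_p)) x :
  submonoid V -> submonoid N -> closed N -> N `<=` V -> V x ->
  (forall d, X d -> locconst d) -> (forall d, X d -> additive_on V d) ->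
  (forall c, zspan X c -> (forall n, N n -> c n = 0) -> c x = 0) ->
  exists2 n, N n & forall d, X d -> d n = d x.
Proof.
move=> sV sN clN NV Vx lX Xadd Xx.
apply: (compact_seq_agree (t := fun d => d x)) => // [|s sX].
  exact: subclosed_compact clN (@pg_compact G) _.
apply: (simultaneous_solution sV) => // [d /sX/Xadd//|c sc].
by apply: Xx; apply: zspanS sc => d /sX.
Qed.

End AdditiveFunctions.
End FiniteDuality.

(** * Equivariant functions and transgression *)

Section EquivariantFunction.
Variables (p : nat) (U : profinGroup) (i : 'Z_p -> U).
Hypotheses (iD : forall a b, i (a + b) = i a ** i b) (i_inj : injective i).

Let i0 : i 0 = pg_one.
Proof. by apply: pg_idem1; rewrite -iD addr0. Qed.

Lemma pg_mulg_continuous (g : U) : continuous (fun x : U => g ** x).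
Proof.
move=> x; have cg : (fun y : U => (g, y)) y @[y --> x] --> (g, x).
  by apply: cvg_pair; [apply: cvg_cst|apply: cvg_id].
exact: (continuous_comp cg (@pg_mul_cont U (g, x))).
Qed.

(** A partial solution: [e] indicates a clopen set stable under translation by [i], and [c] is
    equivariant on that set only. *)
Definition equivariant_on (e : U -> bool) (c : U -> 'Z_p) :=
  [/\ locconst e, locconst c, forall a x, e (i a ** x) = e x &
      forall a x, e x -> c (i a ** x) = a + c x].

(** Zero-dimensionality separates [u] from its finitely many other translates, giving a clopen
    neighbourhood with disjoint translates; [c] records the translate in which a point lies. *)
Lemma equivariant_near (u : U) : exists e c, equivariant_on e c /\ e u.
Proof.
have zU : zero_dimensional U.
  by apply: compact_totally_disconnected_zero_dimensional;
    [apply: pg_hausdorff|apply: pg_compact|apply: pg_tdisc].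
have /choice[D Dsep] (a : 'Z_p) :
    exists D : set U, [/\ clopen D, D u & a != 0 -> ~ D (i a ** u)].
  have [->|a0] := eqVneq a 0.
    by exists setT; split=> //; split; [apply: openT|apply: closedT].
  have [|D [cD Du nD]] := zU u (i a ** u); last by exists D.
  apply: contraNneq a0 => uau; apply/eqP/i_inj; rewrite i0.
  by rewrite -(pg_mulgK (i a) u) -uau pg_mulgV.
pose d a x := `[< D a x >].
have ld a : locconst (d a) by apply: clopen_locconst; case: (Dsep a).
have ltr (R : Type) a (f : U -> R) : locconst f -> locconst (fun x => f (i a ** x)).
  exact/locconst_comp/pg_mulg_continuous.
(* [w] is the indicator of a neighbourhood of [u] disjoint from its translates. *)
pose w x := [forall (a : 'Z_p | a != 0), d a x && ~~ d a (i a ** x)].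
have lw : locconst w.
  rewrite (_ : w = fun x => \big[andb/true]_(a | a != 0) (d a x && ~~ d a (i a ** x)));
    last by apply/funext => x; rewrite big_andE.
  apply: locconst_big => a; apply: locconst_map2; first exact: ld.
  exact/locconst_map/ltr.
have wu : w u.
  apply/forall_inP => a a0; have [_ Du nD] := Dsep a.
  by rewrite /d asboolT //= asboolF //; apply: nD.
have wtr a x : w x -> w (i a ** x) = (a == 0).
  move=> wx; have [->|a0] := eqVneq a 0; first by rewrite i0 pg_mul1g.
  apply/negP => /forall_inP/(_ a a0)/andP[dax _].
  by move/forall_inP: wx => /(_ a a0); rewrite dax andbF.
pose e x := [exists a : 'Z_p, w (i a ** x)].
(* The translates of [w] are disjoint, so at most one term of the sum is nonzero. *)
pose c x := \sum_(a : 'Z_p) (if w (i (- a) ** x) then a else 0).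
have cE a x : w x -> c (i a ** x) = a.
  move=> wx; rewrite /c (bigD1 a) //= big1 => [|b ba].
    by rewrite pg_mulA -iD wtr // addNr eqxx addr0.
  by rewrite pg_mulA -iD wtr // addrC subr_eq0 eq_sym (negPf ba).
exists e, c; split; last by apply/existsP; exists 0; rewrite i0 pg_mul1g.
split.
- rewrite (_ : e = fun x => \big[orb/false]_a w (i a ** x));
    last by apply/funext => x; rewrite big_orE.
  by apply: locconst_big => a; apply: ltr.
- apply: locconst_big => a.
  by apply: (locconst_map (fun b : bool => if b then a else 0)); apply: ltr.
- move=> a x; apply/existsP/existsP => -[b wb].
    by exists (b + a); rewrite iD -pg_mulA.
  by exists (b - a); rewrite pg_mulA -iD subrK.
- move=> a x /existsP[b wb].
  have -> : x = i (- b) ** (i b ** x) by rewrite pg_mulA -iD addNr i0 pg_mul1g.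
  by rewrite pg_mulA -iD !cE.
Qed.

(** Finitely many partial solutions cover the compact group [U]. Two of them are glued by using the
    second only outside the domain of the first, which is clopen and translation stable. *)
Lemma exists_equivariant : exists c : U -> 'Z_p,
  [/\ locconst c, c pg_one = 0 & forall a x, c (i a ** x) = a + c x].
Proof.
suff [e [c [[_ lc _ ce] e1]]] : exists e c, equivariant_on e c /\ forall x, e x.
  exists (fun x => c x - c pg_one); split=> [||a x].
  - exact: (locconst_map (fun b => b - c pg_one)).
  - by rewrite subrr.
  - by rewrite ce // addrA.
(* [D] collects the complements of the domains, so that a cover by domains becomes a subfamily with
   empty intersection. *)
pose D : set (set U) :=
  [set B | exists e c, equivariant_on e c /\ B = e @^-1` [set false]].
have [s sD sU] : exists2 s : seq (set U), (forall B, B \in s -> D B) &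
    forall x, ~ (forall B, B \in s -> B x).
  apply: contrapT => nos.
  have [B [e [c [[le _ _ _] ->]]]|s sD|x _ xD] :=
    compact_seq_fip (D := D) (@pg_compact U).
  - exact: locconst_closed.
  - apply: contrapT => nox; apply: nos; exists s => // x xs.
    by apply: nox; exists x.
  have [e [c [ec ex]]] := equivariant_near x.
  by have := xD (e @^-1` [set false]); rewrite /= ex => h; have [] : true = false;
    first by apply: h; exists e, c.
suff [e [c [ec es]]] : exists e c, equivariant_on e c /\
    forall x, e x = false -> forall B, B \in s -> B x.
  exists e, c; split=> // x; case ex: (e x) => //.
  by case: (sU x); apply: es.
elim: s sD {sU} => [|B s IHs] sD.
  exists (fun _ => false), (fun _ => 0); split=> //.
  by split=> //; apply: locconst_cst.
have [e1 [c1 [[le1 lc1 ie1 ce1] B1]]] := sD B (mem_head _ _).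
have [|e2 [c2 [[le2 lc2 ie2 ce2] s2]]] := IHs.
  by move=> C Cs; apply: sD; rewrite inE Cs orbT.
exists (fun x => e1 x || e2 x), (fun x => if e1 x then c1 x else c2 x).
split=> [|x /norP[/negPf e1x /negPf e2x] C].
  split=> [|||a x].
  - exact: locconst_map2.
  - apply: (locconst_map2 (fun (b : bool) (z : 'Z_p * 'Z_p) => if b then z.1 else z.2)
      (f := e1) (g := fun x => (c1 x, c2 x))) => //.
    exact: locconst_map2.
  - by move=> a x; rewrite ie1 ie2.
  - by rewrite ie1; case: ifP => [e1x _|_ /= e2x]; [apply: ce1|apply: ce2].
by rewrite inE => /orP[/eqP->|/(s2 _ e2x)//]; rewrite B1.
Qed.

End EquivariantFunction.

(** * Transgression of semiadditive functions along a surjection *)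

Section Transgression.
Variable p : nat.
Implicit Types G H : profinGroup.

(** The negative of the coboundary of [c] in the sign convention of [coboundary2]. *)
Definition dcoch G (c : G -> 'Z_p) (x y : G) : 'Z_p := c (x ** y) - c x - c y.

(** For [V] a kernel, this makes [dcoch c] depend only on cosets modulo [V], and [c] restricts to a
    conjugation-invariant character of [V]. *)
Definition semiadditive G (V : set G) (c : G -> 'Z_p) :=
  locconst c /\
  forall v x, V v -> c (v ** x) = c v + c x /\ c (x ** v) = c x + c v.

Lemma semiadditive0 G (V : set G) : semiadditive V (fun _ : G => 0 : 'Z_p).
Proof. by split=> [|v x _]; [apply: locconst_cst|rewrite addr0]. Qed.

Lemma semiadditiveD G (V : set G) (c d : G -> 'Z_p) :
  semiadditive V c -> semiadditive V d -> semiadditive V (fun x => c x + d x).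
Proof.
move=> [lc cV] [ld dV]; split=> [|v x Vv]; first exact: locconst_map2.
have [cl cr] := cV v x Vv; have [dl dr] := dV v x Vv.
by rewrite cl cr dl dr; split; ring.
Qed.

Lemma semiadditiveN G (V : set G) (c : G -> 'Z_p) :
  semiadditive V c -> semiadditive V (fun x => - c x).
Proof.
move=> [lc cV]; split=> [|v x Vv]; first exact: locconst_map.
by have [cl cr] := cV v x Vv; rewrite cl cr; split; ring.
Qed.

Lemma semiadditiveS G (W V : set G) (c : G -> 'Z_p) :
  W `<=` V -> semiadditive V c -> semiadditive W c.
Proof. by move=> WV [lc cV]; split=> // v x /WV; apply: cV. Qed.

(* Up to sign, the class to which the transgression of the five-term sequence
   sends the restriction of a semiadditive [c] to the kernel of [f]. *)
Definition transgression G H (f : G -> H) (c : G -> 'Z_p) : set (H * H -> 'Z_p) :=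
  [set w | exists z, (forall x y, z (f x, f y) = dcoch c x y) /\
                     coboundary2 (fun xy => w xy - z xy)].

Lemma coboundary2_0 G : coboundary2 (fun _ : G * G => 0 : 'Z_p).
Proof.
by exists (fun _ => 0); split=> [|g h]; [apply: locconst_cst|ring].
Qed.

Lemma coboundary2D G (z w : G * G -> 'Z_p) :
  coboundary2 z -> coboundary2 w -> coboundary2 (fun x => z x + w x).
Proof.
move=> [c [lc cz]] [d [ld dw]]; exists (fun x => c x + d x).
by split=> [|g h]; [apply: locconst_map2|rewrite cz dw; ring].
Qed.

Lemma coboundary2N G (z : G * G -> 'Z_p) :
  coboundary2 z -> coboundary2 (fun x => - z x).
Proof.
move=> [c [lc cz]]; exists (fun x => - c x).
by split=> [|g h]; [apply: locconst_map|rewrite cz; ring].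
Qed.

Lemma coboundary2_eq G (z w : G * G -> 'Z_p) :
  coboundary2 z -> z =1 w -> coboundary2 w.
Proof. by move=> zb /funext <-. Qed.

Lemma coboundary2_comp G H (f : G -> H) (z : H * H -> 'Z_p) :
  chom f -> coboundary2 z -> coboundary2 (fun x => z (f x.1, f x.2)).
Proof.
move=> [cf fM] [c [lc cz]]; exists (fun x => c (f x)).
by split=> [|g h]; [apply: locconst_comp|rewrite cz fM].
Qed.

Lemma h2class_eqP G (z w : G * G -> 'Z_p) :
  h2class z = h2class w <-> coboundary2 (fun x => z x - w x).
Proof.
split=> [zw|zw].
  have : h2class z z by apply: coboundary2_eq (coboundary2_0 _) _ => x; ring.
  by rewrite zw.
apply/seteqP; split=> u /= uz.
  by apply: coboundary2_eq (coboundary2D uz zw) _ => x; ring.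
by apply: coboundary2_eq (coboundary2D uz (coboundary2N zw)) _ => x; ring.
Qed.

Lemma h2class_refl G (z : G * G -> 'Z_p) : h2class z z.
Proof. by apply: coboundary2_eq (coboundary2_0 _) _ => x; ring. Qed.

Lemma h2pull_class G H (f : G -> H) (z : H * H -> 'Z_p) : chom f ->
  h2pull f (h2class z) = h2class (fun x => z (f x.1, f x.2)).
Proof.
move=> fh; apply/seteqP; split=> [w [u [/(coboundary2_comp fh) zu uw]]|w wz].
  by apply: coboundary2_eq (coboundary2D uw zu) _ => x /=; ring.
by exists z; split=> //; apply: h2class_refl.
Qed.

Section Surjection.
Variables (G H : profinGroup) (f : G -> H).
Hypotheses (fh : chom f) (sf : forall y, exists x, f x = y).

Lemma transgressionE c z : (forall x y, z (f x, f y) = dcoch c x y) ->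
  transgression f c = h2class z.
Proof.
move=> zc; apply/seteqP; split=> [w [z' [z'c]]|w wz]; last by exists z.
suff -> : z' = z by [].
apply/funext => -[y1 y2]; have [x1 <-] := sf y1; have [x2 <-] := sf y2.
by rewrite z'c zc.
Qed.

(** The cocycle is [dcoch c] on chosen representatives. Independence of the choice lets local
    constancy descend from the compact group and lets the cocycle identity be checked on [G]. *)
Lemma exists_transgression c : semiadditive (hkernel f) c ->
  exists2 z, cocycle2 z & forall x y, z (f x, f y) = dcoch c x y.
Proof.
move=> [lc cV]; have [s sP] := choice sf.
pose z (xy : H * H) := dcoch c (s xy.1) (s xy.2).
have zE x y : z (f x, f y) = dcoch c x y.
  rewrite /z /=.
  have [v fv sx] := chom_eq_ker fh (sP (f x)).
  have [w fw sy] := chom_eq_ker fh (sP (f y)).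
  (* Moving [v] past [y] replaces it by a conjugate [k], at which [c] has the same value. *)
  have [k fk vy] : exists2 k, f k = pg_one & v ** y = y ** k.
    apply: chom_eq_ker => //; case: (fh) => _ fM.
    by rewrite fM fv pg_mul1g.
  have ck : c k = c v.
    by apply: (addrI (c y)); rewrite -(cV _ y fk).2 -vy (cV _ y fv).1 addrC.
  rewrite sx sy /dcoch -!pg_mulA (pg_mulA v) vy -pg_mulA !pg_mulA.
  by rewrite (cV _ _ fw).2 (cV _ _ fk).2 (cV _ x fv).2 (cV _ y fw).2 ck; ring.
exists z => //; split.
  apply: (locconst_descends (S := (G * G)%type) (f := fun x => (f x.1, f x.2))).
  - by rewrite -setXTT; apply: compact_setX; apply: pg_compact.
  - by apply: hausdorff_prod; apply: pg_hausdorff.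
  - move=> x; case: (fh) => cf _; apply: cvg_pair.
      exact: (continuous_comp (@cvg_fst _ _ _ _ _) (cf x.1)).
    exact: (continuous_comp (@cvg_snd _ _ _ _ _) (cf x.2)).
  - by move=> [y1 y2]; have [x1 <-] := sf y1; have [x2 <-] := sf y2;
      exists (x1, x2).
  rewrite (_ : (fun _ => _) = fun x => dcoch c x.1 x.2);
    last by apply/funext => x; apply: zE.
  apply: (locconst_map2 (fun a b => a - b)
    (f := fun x : G * G => c (x.1 ** x.2) - c x.1) (g := fun x => c x.2)).
    apply: (locconst_map2 (fun a b => a - b)
      (f := fun x : G * G => c (x.1 ** x.2)) (g := fun x => c x.1)).
      exact: (locconst_comp (g := fun x : G * G => x.1 ** x.2) (@pg_mul_cont G)).
    by apply: (locconst_comp (g := fst)) => // x; apply: cvg_fst.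
  by apply: (locconst_comp (g := snd)) => // x; apply: cvg_snd.
move=> y1 y2 y3; have [x1 <-] := sf y1; have [x2 <-] := sf y2.
have [x3 <-] := sf y3; case: (fh) => _ fM.
by rewrite -!fM !zE /dcoch pg_mulA; ring.
Qed.

(** If [z] is the coboundary of [b], then [c] plus the pullback of [b] is a character of [G], hence
    zero on the kernel of [f], where [b] contributes only its value at 1, which is 0. Conversely, if
    [c] vanishes on the kernel, [- c] descends to a cochain on [H] with coboundary [z]. *)
Lemma coboundary_descends c z :
  (forall chi : G -> 'Z_p, locconst chi ->
     (forall x y, chi (x ** y) = chi x + chi y) ->
     forall x, f x = pg_one -> chi x = 0) ->
  semiadditive (hkernel f) c -> (forall x y, z (f x, f y) = dcoch c x y) ->
  coboundary2 z <-> forall x, f x = pg_one -> c x = 0.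
Proof.
move=> chi0 [lc cV] zc; split=> [[b [lb bz]] x fx|c0].
  pose chi x := c x + b (f x); case: (fh) => cf fM.
  have chiD y1 y2 : chi (y1 ** y2) = chi y1 + chi y2.
    have := zc y1 y2; rewrite bz /chi -fM /dcoch => h.
    apply/eqP; rewrite -subr_eq0; apply/eqP.
    by rewrite -(subrr (b (f y2) - b (f (y1 ** y2)) + b (f y1))) {1}h; ring.
  have lchi : locconst chi by apply: locconst_map2 => //; apply: locconst_comp.
  have f1 := chom1 fh.
  have c1 : c pg_one = 0.
    by have [+ _] := cV pg_one pg_one f1; rewrite pg_mul1g => h;
      apply: (addrI (c pg_one)); rewrite -h addr0.
  have := chi0 chi lchi chiD _ f1; rewrite /chi c1 f1 add0r => b1.
  by have := chi0 chi lchi chiD _ fx; rewrite /chi fx b1 addr0.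
have [s sP] := choice sf.
have cs x : c (s (f x)) = c x.
  have [v fv ->] := chom_eq_ker fh (sP (f x)).
  by rewrite (cV _ _ fv).2 (c0 _ fv) addr0.
exists (fun y => - c (s y)); split=> [|y1 y2].
  apply: locconst_map.
  apply: (locconst_descends (f := f)) => //.
  - exact: pg_compact.
  - exact: pg_hausdorff.
  - by case: fh.
  - by rewrite (_ : (fun x => c (s (f x))) = c) //; apply/funext.
have [x1 <-] := sf y1; have [x2 <-] := sf y2.
by rewrite zc; case: (fh) => _ <-; rewrite !cs /dcoch; ring.
Qed.

End Surjection.

End Transgression.

Section TransgressionAlgebra.
Variables (p : nat) (G H : profinGroup) (f : G -> H).
Hypotheses (fh : chom f) (sf : forall y, exists x, f x = y).
Implicit Types c d : G -> 'Z_p.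

Lemma transgression0 : transgression f (fun _ => 0 : 'Z_p) = @h2zero p H.
Proof. by apply: transgressionE => // x y; rewrite /dcoch; ring. Qed.

Lemma transgressionD c d :
  semiadditive (hkernel f) c -> semiadditive (hkernel f) d ->
  transgression f (fun x => c x + d x) =
  h2add (transgression f c) (transgression f d).
Proof.
move=> /(exists_transgression fh sf)[z _ zc] /(exists_transgression fh sf)[w _ wd].
rewrite (transgressionE sf zc) (transgressionE sf wd).
rewrite (transgressionE (z := fun x => z x + w x) sf) => [|x y]; last first.
  by rewrite zc wd /dcoch; ring.
apply/seteqP; split=> [u zw|u [a [b [za wb ->]]]].
  exists (fun x => u x - w x), w; split.
  - by apply: coboundary2_eq zw _ => x; ring.
  - exact: h2class_refl.
  - by apply/funext => x; ring.
by apply: coboundary2_eq (coboundary2D za wb) _ => x; ring.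
Qed.

Lemma transgressionN c : semiadditive (hkernel f) c ->
  transgression f (fun x => - c x) = h2opp (transgression f c).
Proof.
move=> /(exists_transgression fh sf)[z _ zc]; rewrite (transgressionE sf zc).
rewrite (transgressionE (z := fun x => - z x) sf) => [|x y]; last first.
  by rewrite zc /dcoch; ring.
by apply/seteqP; split=> u zu; apply: coboundary2_eq (coboundary2N zu) _ => x; ring.
Qed.

Lemma transgression_isH2 c : semiadditive (hkernel f) c ->
  isH2 (transgression f c).
Proof.
move=> /(exists_transgression fh sf)[z zcoc zc].
by exists z; split=> //; apply: transgressionE.
Qed.

Lemma zspan_semiadditive V (Y : set (G -> 'Z_p)) c :
  (forall d, Y d -> semiadditive V d) -> zspan Y c -> semiadditive V c.
Proof.
move=> YV; elim=> [d /YV//||d d' _ dV _ d'V|d _ dV].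
- exact: semiadditive0.
- exact: semiadditiveD.
- exact: semiadditiveN.
Qed.

(** Transgression is additive: the image of the span is itself a subgroup, which bounds [h2gen] from
    above, and induction on [zspan] gives the other inclusion. *)
Lemma h2gen_transgression (Y : set (G -> 'Z_p)) :
  (forall d, Y d -> semiadditive (hkernel f) d) ->
  h2gen (transgression f @` Y) = transgression f @` zspan Y.
Proof.
move=> YV; have spV c := zspan_semiadditive (c := c) YV.
apply/seteqP; split=> [A [_]|_ [c Yc <-]].
  apply=> [|_ _ [c Yc <-] [d Yd <-]|_ [c Yc <-]|_ [c Yc <-]].
  - by exists (fun _ => 0); [apply: zspan0|apply: transgression0].
  - exists (fun x => c x + d x); first exact: zspanD.
    by apply: transgressionD; apply: spV.
  - exists (fun x => - c x); first exact: zspanN.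
    by apply: transgressionN; apply: spV.
  - by exists c => //; apply: zspan_gen.
split=> [|S S0 SD SN YS]; first exact/transgression_isH2/spV.
elim: Yc => [d Yd||d d' Yd Sd Yd' Sd'|d Yd Sd].
- by apply: YS; exists d.
- by rewrite transgression0.
- by rewrite transgressionD; [apply: SD|apply: spV|apply: spV].
- by rewrite transgressionN; [apply: SN|apply: spV].
Qed.

Lemma transgression_eqP c d :
  (forall chi : G -> 'Z_p, locconst chi ->
     (forall x y, chi (x ** y) = chi x + chi y) ->
     forall x, f x = pg_one -> chi x = 0) ->
  semiadditive (hkernel f) c -> semiadditive (hkernel f) d ->
  transgression f c = transgression f d <-> forall x, f x = pg_one -> c x = d x.
Proof.
move=> chi0 cV dV.
have [z _ zc] := exists_transgression fh sf cV.
have [w _ wd] := exists_transgression fh sf dV.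
rewrite (transgressionE sf zc) (transgressionE sf wd).
apply: (iff_trans (h2class_eqP _ _)).
apply: (iff_trans (coboundary_descends (c := fun x => c x - d x) fh sf chi0 _ _)).
- by apply: semiadditiveD => //; apply: semiadditiveN.
- by move=> x y; rewrite zc wd /dcoch; ring.
- split=> cd x fx; last by rewrite cd // subrr.
  by apply/eqP; rewrite -subr_eq0 cd.
Qed.

End TransgressionAlgebra.

(** * The class of a central extension as a transgression *)

Section Extension.
Variables (p : nat) (w : cext p) (c : ce_U w -> 'Z_p).
Hypotheses (lc : locconst c) (c1 : c pg_one = 0)
  (ce : forall a u, c (ce_iota w a ** u) = a + c u).

Lemma equivariant_iota a : c (ce_iota w a) = a.
Proof. by rewrite -[ce_iota w a]pg_mulg1 ce c1 addr0. Qed.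

Lemma equivariant_semiadditive : semiadditive (hkernel (ce_lam w)) c.
Proof.
split=> // v x /ce_exact[a <-].
by rewrite -ce_central ce equivariant_iota; split; [|rewrite addrC].
Qed.

(** For a continuous section [s], the factor set of [s] differs from the transgressed cocycle [F] by
    the coboundary of [c \o s]. Conversely, the section with [c \o s = 0] is continuous and has
    factor set exactly [F]. *)
Lemma ext_class_transgression : ext_class w = transgression (ce_lam w) c.
Proof.
have lamh := ce_lam_hom w; have slam := @ce_lam_surj p w.
have [F _ FE] := exists_transgression lamh slam equivariant_semiadditive.
rewrite (transgressionE slam FE); case: (lamh) => _ lamM.
have lift_eq u u' : ce_lam w u = ce_lam w u' -> exists a, u = ce_iota w a ** u'.
  move=> uu'; have /ce_exact[a uE] : ce_lam w (u ** pg_inv u') = pg_one.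
    by rewrite lamM chomV // uu' pg_mulgV.
  by exists a; rewrite uE -pg_mulA pg_mulVg pg_mulg1.
apply/seteqP; split=> [z [s [f [cs sP fE zf]]]|z zF].
  have fF : coboundary2 (fun xy => f xy - F xy).
    exists (fun x => c (s x)); split=> [|x y]; first exact: locconst_comp.
    have := FE (s x) (s y); rewrite !sP /dcoch.
    rewrite -(pg_mulgK (s x ** s y) (pg_inv (s (x ** y)))) pg_invgK -fE ce => ->.
    by ring.
  by apply: coboundary2_eq (coboundary2D zf fF) _ => x; ring.
have [s0 s0P] := choice slam.
(* An arbitrary section is shifted into the zero set of [c]; the result no longer depends on [s0],
   since each fibre of [ce_lam w] meets that zero set once. *)
pose s x := ce_iota w (- c (s0 x)) ** s0 x.
have lam_iota a : ce_lam w (ce_iota w a) = pg_one by apply/ce_exact; exists a.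
have sP x : ce_lam w (s x) = x by rewrite lamM lam_iota pg_mul1g s0P.
have cs x : c (s x) = 0 by rewrite ce addNr.
have slamE u : s (ce_lam w u) = ce_iota w (- c u) ** u.
  have [a ua] := lift_eq _ _ (s0P (ce_lam w u)).
  by rewrite /s ua ce pg_mulA -ce_iota_hom; congr (ce_iota w _ ** _); ring.
exists s, F; split=> //.
  apply: (continuous_descends (f := ce_lam w)) => //.
  - exact: pg_compact.
  - exact: pg_hausdorff.
  - by case: lamh.
  - rewrite (_ : s \o ce_lam w = fun u => ce_iota w (- c u) ** u); last exact/funext.
    move=> u; have cp : (fun v => (ce_iota w (- c v), v)) v @[v --> u] -->
        (ce_iota w (- c u), u).
      apply: cvg_pair; last exact: cvg_id.
      by apply: (locconst_continuous (f := fun v => ce_iota w (- c v)));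
        apply: (locconst_map (fun a => ce_iota w (- a))).
    exact: (continuous_comp cp (@pg_mul_cont (ce_U w) (ce_iota w (- c u), u))).
move=> x y; have [a sa] : exists a, s x ** s y = ce_iota w a ** s (x ** y).
  by apply: lift_eq; rewrite lamM !sP.
have := FE (s x) (s y); rewrite !sP /dcoch sa ce !cs !subr0 addr0 => ->.
by rewrite pg_mulgK.
Qed.

(** Since [rho] lifts [rb], the pulled-back cocycle becomes [dcoch] of [c \o rho] on [G]. *)
Lemma h2pull_ext_class (G H : profinGroup) (f : G -> H) (rho : G -> ce_U w)
  (rb : H -> ce_Ub w) :
  (forall y, exists x, f x = y) -> chom rho -> chom rb ->
  (forall g, ce_lam w (rho g) = rb (f g)) ->
  h2pull rb (ext_class w) = transgression f (fun x => c (rho x)).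
Proof.
move=> sf rhoh rbh lrho; have lamh := ce_lam_hom w; have slam := @ce_lam_surj p w.
have [F _ FE] := exists_transgression lamh slam equivariant_semiadditive.
rewrite ext_class_transgression (transgressionE slam FE) h2pull_class //.
apply/esym/transgressionE => // x y /=; rewrite -!lrho FE /dcoch.
by case: rhoh => _ ->.
Qed.

End Extension.

(** * Kernels and the consequences of conditions (I) and (II) *)

Lemma hkernel_closed (G H : profinGroup) (f : G -> H) : chom f -> closed (hkernel f).
Proof.
move=> [/continuous_closedP cf _]; apply: (cf [set pg_one]).
by apply: compact_closed; [apply: pg_hausdorff|apply: compact_set1].
Qed.

Lemma hkernel_submonoid (G H : profinGroup) (f : G -> H) :
  chom f -> submonoid (hkernel f).
Proof.
move=> fh; split=> [|x y fx fy]; first exact: chom1.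
by rewrite /hkernel /=; case: fh => _ ->; rewrite fx fy pg_mul1g.
Qed.

(** Composing a homomorphism to [ce_Ub] with the maps of (I) gives homomorphisms to [ce_U], which
    jointly detect whether its value is trivial. *)
Lemma Tset_sub_Tbar p I (Om : I -> cext p) (G : profinGroup) :
  (forall i, condI (Om i)) -> Tset Om G `<=` Tbar Om G.
Proof.
move=> HI x Tx i f fh; have [n [gam [gamh]]] := HI i; apply=> j.
exact: (Tx i _ (chom_comp fh (gamh j))).
Qed.

(** The embedding of (II) turns a character into a homomorphism to [ce_Ub]. *)
Lemma character_Tbar p I (i0 : I) (Om : I -> cext p) (G : profinGroup)
  (chi : G -> 'Z_p) : condII (Om i0) -> locconst chi ->
  (forall x y, chi (x ** y) = chi x + chi y) ->
  forall x, Tbar Om G x -> chi x = 0.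
Proof.
move=> [e [e_inj eD]] lchi chiD x Tx; apply: e_inj.
have -> : e 0 = pg_one by apply: pg_idem1; rewrite -eD addr0.
apply: (Tx i0 (e \o chi)); split=> [|y z /=]; last by rewrite chiD eD.
by apply: locconst_continuous; apply: locconst_map.
Qed.

(** * Comparison of the two conditions *)

Section Pullbacks.
Variables (p : nat) (I : Type) (Om : I -> cext p) (cU : forall i, ce_U (Om i) -> 'Z_p).
Arguments cU : clear implicits.
Hypotheses (cU_lc : forall i, locconst (cU i)) (cU1 : forall i, cU i pg_one = 0)
  (cUE : forall i a u, cU i (ce_iota (Om i) a ** u) = a + cU i u).
Arguments cU_lc : clear implicits.
Arguments cUE : clear implicits.
Hypothesis HI : forall i, condI (Om i).

(** The set P of the overview; [unramified_pullbacks] below is P0. *)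
Definition pullbacks (G : profinGroup) : set (G -> 'Z_p) :=
  [set c | exists i (rho : G -> ce_U (Om i)), chom rho /\ c = cU i \o rho].
Arguments pullbacks : clear implicits.

Lemma Tbar_iota (G : profinGroup) i (rho : G -> ce_U (Om i)) x :
  chom rho -> Tbar Om G x -> exists a, ce_iota (Om i) a = rho x.
Proof.
move=> rhoh Tx; apply/ce_exact.
exact: (Tx i _ (chom_comp rhoh (ce_lam_hom (Om i)))).
Qed.

Lemma pullbacks_semiadditive (G : profinGroup) (c : G -> 'Z_p) :
  pullbacks G c -> semiadditive (Tbar Om G) c.
Proof.
move=> [i [rho [rhoh ->]]]; case: (rhoh) => crho rhoM.
split=> [|v x Tv]; first exact: locconst_comp.
have [_ cV] := equivariant_semiadditive (cU_lc i) (cU1 i) (cUE i).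
rewrite /= !rhoM; apply: cV; apply/ce_exact; exact: Tbar_iota.
Qed.

(** On [Tbar Om G] the values of [rho] lie in the image of [ce_iota], where [cU i] inverts
    [ce_iota]. *)
Lemma pullback_eq0 (G : profinGroup) i (rho : G -> ce_U (Om i)) x :
  chom rho -> Tbar Om G x -> cU i (rho x) = 0 -> rho x = pg_one.
Proof.
move=> rhoh /(Tbar_iota rhoh)[a <-].
rewrite (equivariant_iota (cU1 i) (cUE i)) => ->.
by apply: pg_idem1; rewrite -ce_iota_hom addr0.
Qed.

Lemma TsetP (G : profinGroup) x :
  Tset Om G x <-> Tbar Om G x /\ forall c, pullbacks G c -> c x = 0.
Proof.
split=> [Tx|[Vx Px] i rho rhoh].
  split=> [|_ [i [rho [rhoh ->]]] /=]; first exact: Tset_sub_Tbar HI _ Tx.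
  by rewrite (Tx i rho rhoh).
by apply: pullback_eq0 => //; apply: (Px (cU i \o rho)); exists i, rho.
Qed.

(** Every [rho] is a lift of something: its composite with [ce_lam] kills [Tbar Om G], the kernel of
    [pib], and so descends to [Gb]. *)
Lemma PiSet_transgression (G Gb : profinGroup) (pib : G -> Gb) :
  chom pib -> (forall y, exists x, pib x = y) -> hkernel pib = Tbar Om G ->
  PiSet Om pib = transgression pib @` pullbacks G.
Proof.
move=> pibh spib pib_ker.
apply/seteqP; split=> [_ [i [rb [rbh [rho [rhoh lrho]] ->]]]|].
  exists (cU i \o rho); first by exists i, rho.
  exact/esym/(h2pull_ext_class (cU_lc i) (cU1 i) (cUE i) spib rhoh rbh lrho).
move=> _ [_ [i [rho [rhoh ->]]] <-].
have lrhoh := chom_comp rhoh (ce_lam_hom (Om i)).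
have [|rb rbh rbE] := chom_descends pibh spib lrhoh.
  move=> x pibx; have : Tbar Om G x by rewrite -pib_ker.
  by move/(_ i); apply.
exists i, rb; split=> //; first by exists rho; split.
apply/esym.
by apply: (h2pull_ext_class (cU_lc i) (cU1 i) (cUE i) spib rhoh rbh) => g; rewrite rbE.
Qed.

(** * Passage to the quotient by N *)

Section Quotient.
Variables (G Q : profinGroup) (pi : G -> Q).
Hypotheses (pi_hom : chom pi) (pi_surj : forall y, exists x, pi x = y).
Hypothesis pi_ker : hkernel pi `<=` Tbar Om G.

Definition unramified_pullbacks : set (G -> 'Z_p) :=
  [set c | pullbacks G c /\ forall n, hkernel pi n -> c n = 0].

(** Homomorphisms from [Q] to [ce_U] correspond to those from [G] that kill the kernel of [pi], that
    is, whose composite with [cU i] vanishes there. *)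
Lemma Tset_quotientP x : Tset Om Q (pi x) <->
  Tbar Om G x /\ forall c, unramified_pullbacks c -> c x = 0.
Proof.
split=> [Tx|[Vx Px]].
  split=> [i f fh|_ [[i [rho [rhoh ->]]] rho0] /=].
    have [n /pi_ker nV|f' f'h f'E] := chom_descends pi_hom pi_surj fh.
      exact: nV.
    by rewrite -f'E; apply: (Tset_sub_Tbar HI Tx).
  have [n nN|f' f'h f'E] := chom_descends pi_hom pi_surj rhoh.
    by apply: pullback_eq0 => //; [apply: pi_ker|apply: rho0].
  by rewrite -f'E (Tx i f' f'h).
move=> i rho rhoh; have rpih := chom_comp pi_hom rhoh.
apply: (pullback_eq0 rpih Vx).
apply: (Px (cU i \o (rho \o pi))); split; first by exists i, (rho \o pi).
move=> n; rewrite /hkernel /= => ->.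
by rewrite chom1.
Qed.

Variables (Gb : profinGroup) (pib : G -> Gb) (q : Q -> Gb).
Hypotheses (pib_hom : chom pib) (pib_surj : forall y, exists x, pib x = y)
  (pib_ker : hkernel pib = Tbar Om G).
Hypotheses (q_hom : chom q) (q_pi : forall g, q (pi g) = pib g).
Hypothesis chi0 : forall chi : G -> 'Z_p, locconst chi ->
  (forall x y, chi (x ** y) = chi x + chi y) -> forall x, Tbar Om G x -> chi x = 0.

(** Inflating the transgression of [c] along [pib] gives its transgression along [pi], to which
    [coboundary_descends] applies. *)
Lemma Kerinf_transgression c : semiadditive (Tbar Om G) c ->
  Kerinf p q (transgression pib c) <-> forall n, hkernel pi n -> c n = 0.
Proof.
move=> cV; have cV' := cV; rewrite -pib_ker in cV'.
have [z _ zc] := exists_transgression pib_hom pib_surj cV'.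
have infE : h2pull q (transgression pib c) = @h2zero p Q <->
    forall n, hkernel pi n -> c n = 0.
  rewrite (transgressionE pib_surj zc) h2pull_class //.
  apply: (iff_trans (h2class_eqP _ _)).
  apply: (coboundary_descends pi_hom pi_surj).
  - by move=> chi lchi chiD x /pi_ker; apply: chi0.
  - exact: semiadditiveS cV.
  - by move=> x y; rewrite /= !q_pi zc subr0.
split=> [[_ /infE]//|/infE cN]; split=> //.
exact: transgression_isH2.
Qed.

(** Under transgression, the left side becomes the span of P0 and the right side the elements of the
    span of P vanishing on N; two classes agree exactly when the functions agree on [Tbar Om G]. *)
Lemma h2gen_Kerinf_iff :
  h2gen (PiSet Om pib `&` Kerinf p q) = h2gen (PiSet Om pib) `&` Kerinf p q <->
  forall c, zspan (pullbacks G) c -> (forall n, hkernel pi n -> c n = 0) ->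
    exists2 c', zspan unramified_pullbacks c' & forall x, Tbar Om G x -> c x = c' x.
Proof.
have PV c : pullbacks G c -> semiadditive (Tbar Om G) c by apply: pullbacks_semiadditive.
have spV c : zspan (pullbacks G) c -> semiadditive (Tbar Om G) c.
  exact: zspan_semiadditive.
have P0P : unramified_pullbacks `<=` pullbacks G by move=> c [].
have PiE := PiSet_transgression pib_hom pib_surj pib_ker.
have PiK : PiSet Om pib `&` Kerinf p q = transgression pib @` unramified_pullbacks.
  rewrite PiE; apply/seteqP; split=> [_ [[c Pc <-] /(Kerinf_transgression (PV c Pc)) cN]|].
    by exists c.
  move=> _ [c [Pc cN] <-]; split; first by exists c.
  by apply/(Kerinf_transgression (PV c Pc)).
rewrite PiK PiE.
rewrite !(h2gen_transgression pib_hom pib_surj) ?pib_ker //; last by move=> c /P0P/PV.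
have trE c d : zspan (pullbacks G) c -> zspan (pullbacks G) d ->
    transgression pib c = transgression pib d <-> forall x, Tbar Om G x -> c x = d x.
  move=> /spV cV /spV dV; rewrite -pib_ker in cV dV *.
  by apply: transgression_eqP => //; move: chi0; rewrite -pib_ker.
split=> [eqH c Pc cN|eqP0].
  have : (transgression pib @` zspan unramified_pullbacks) (transgression pib c).
    rewrite eqH; split; first by exists c.
    by apply/Kerinf_transgression => //; apply: spV.
  move=> [d P0d dc]; exists d => // x Vx.
  by apply/esym; move: x Vx; apply/trE => //; apply: zspanS P0d.
apply/seteqP; split=> [_ [c P0c <-]|_ [[c Pc <-]]].
  have Pc : zspan (pullbacks G) c by apply: zspanS P0c.
  split; first by exists c.
  apply/Kerinf_transgression => [|n Nn]; first exact: spV.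
  elim: P0c {Pc} => [d [_ dN]||d d' _ dn _ d'n|d _ dn]; rewrite ?dn ?d'n ?oppr0 ?addr0 //.
  exact: dN.
move=> /(Kerinf_transgression (spV c Pc))/(eqP0 c Pc)[d P0d cd].
exists d => //; apply/trE => //; first exact: zspanS P0d.
by move=> x Vx; rewrite cd.
Qed.

Lemma image_Tset_iff : prime p ->
  pi @` Tset Om G = Tset Om Q <->
  forall c, zspan (pullbacks G) c -> (forall n, hkernel pi n -> c n = 0) ->
    exists2 c', zspan unramified_pullbacks c' & forall x, Tbar Om G x -> c x = c' x.
Proof.
move=> p_prime.
have PV c : pullbacks G c -> semiadditive (Tbar Om G) c by apply: pullbacks_semiadditive.
have Padd c : pullbacks G c -> additive_on (Tbar Om G) c.
  by move=> /PV[_ cV] x y Vx _; rewrite (cV x y Vx).1.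
have Plc c : pullbacks G c -> locconst c by move=> /PV[].
have P0P : unramified_pullbacks `<=` pullbacks G by move=> c [].
have sV : submonoid (Tbar Om G) by rewrite -pib_ker; apply: hkernel_submonoid.
have sN := hkernel_submonoid pi_hom.
have clV : closed (Tbar Om G) by rewrite -pib_ker; apply: hkernel_closed.
have clN := hkernel_closed pi_hom.
split=> [eqT c Pc cN|eqP0].
  have spV := zspan_semiadditive PV Pc.
  have cadd := zspan_additive_on Padd Pc.
  apply: (closed_span_of_common_kernel p_prime sV clV) => //.
  - by case: spV.
  - by move=> d /P0P/Plc.
  - by move=> d /P0P/Padd.
  (* By (a), [x] is a product of some [t] in [Tset Om G] and some [n] in the kernel of [pi]; [c]
     vanishes at both. *)
  move=> x Vx P0x; have : Tset Om Q (pi x) by apply/Tset_quotientP.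
  rewrite -eqT => -[t /TsetP[Vt Pt] tx].
  have [n Nn ->] := chom_eq_ker pi_hom (esym tx).
  rewrite cadd ?(cN n Nn) ?addr0 //; last exact: pi_ker.
  rewrite -[RHS](additive_on1 sV cadd); apply: (zspan_eq_at Pc) => d Pd.
  by rewrite Pt // (additive_on1 sV (Padd d Pd)).
apply/seteqP; split=> [_ [x /TsetP[Vx Px] <-]|y].
  by apply/Tset_quotientP; split=> // c /P0P/Px.
have [x <-] := pi_surj y; move=> /Tset_quotientP[Vx P0x].
(* Each [c] in the span of P vanishing on N agrees with an element of the span of P0, hence kills
   [x]. So some [n] in N has the same values as [x] under P, and [pg_inv n ** x] is the required
   preimage in [Tset Om G]. *)
have [c Pc cN|n Nn nx] :=
    closed_simultaneous_solution p_prime sV sN clN pi_ker Vx Plc Padd.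
  have [d P0d ->//] := eqP0 c Pc cN.
  have dadd := zspan_additive_on (fun e Pe => Padd e (P0P e Pe)) P0d.
  rewrite -[RHS](additive_on1 sV dadd); apply: (zspan_eq_at P0d) => e P0e.
  by rewrite P0x // (additive_on1 sV (Padd e (P0P e P0e))).
have Vn := pi_ker Nn.
have pVn : pib (pg_inv n) = pg_one.
  rewrite chomV // (_ : pib n = pg_one); last by move: Vn; rewrite -pib_ker.
  by rewrite -[LHS]pg_mulg1 pg_mulVg.
have Vni : Tbar Om G (pg_inv n) by rewrite -pib_ker.
exists (pg_inv n ** x).
  apply/TsetP; split=> [|c Pc]; first by case: sV => _; apply.
  have cadd := Padd c Pc.
  rewrite cadd // -(nx c Pc) -cadd // pg_mulVg.
  exact: additive_on1 sV cadd.
case: (pi_hom) => _ ->; rewrite chomV // Nn.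
by rewrite -{2}[pi x](pg_mulKg pg_one) pg_mul1g.
Qed.

End Quotient.
End Pullbacks.

(** The quotients by N and by [Tbar Om G] are given as surjections [pi] and [pib] with these
    kernels; [q] is the induced map between them, so [h2pull q] is inflation. *)
Theorem theorem7p5 (p : nat) (p_prime : prime p)
  (I : Type) (i0 : I) (Om : I -> cext p)
  (HI : forall i, condI (Om i)) (HII : forall i, condII (Om i))
  (G : profinGroup) (N : set G) (HN : closed_normal_subgroup N)
  (HNT : N `<=` Tbar Om G)
  (Q : profinGroup) (pi : G -> Q) (pi_hom : chom pi)
  (pi_surj : forall y, exists x, pi x = y) (pi_ker : hkernel pi = N)
  (Gb : profinGroup) (pib : G -> Gb) (pib_hom : chom pib)
  (pib_surj : forall y, exists x, pib x = y) (pib_ker : hkernel pib = Tbar Om G)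
  (q : Q -> Gb) (q_hom : chom q) (q_pi : forall g, q (pi g) = pib g) :
  pi @` Tset Om G = Tset Om Q <->
  h2gen (PiSet Om pib `&` Kerinf p q) = h2gen (PiSet Om pib) `&` Kerinf p q.
Proof.
have cU i := cid (exists_equivariant (@ce_iota_hom p (Om i)) (@ce_iota_inj p (Om i))).
have cU_lc i : locconst (sval (cU i)) by case: (svalP (cU i)).
have cU1 i : sval (cU i) pg_one = 0 by case: (svalP (cU i)).
have cUE i a u : sval (cU i) (pg_mul (ce_iota (Om i) a) u) = a + sval (cU i) u.
  by case: (svalP (cU i)).
have pi_ker' : hkernel pi `<=` Tbar Om G by rewrite pi_ker.
have chi0 chi := @character_Tbar p I i0 Om G chi (HII i0).
apply: (iff_trans (image_Tset_iff cU_lc cU1 cUE HI pi_hom pi_surj pi_ker'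
  pib_hom pib_ker p_prime)).
apply: iff_sym; exact: (h2gen_Kerinf_iff cU_lc cU1 cUE pi_hom pi_surj pi_ker'
  pib_hom pib_surj pib_ker q_hom q_pi chi0).
Qed.
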